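(* Let $f:[a,b]\to\mathbb{R}$ be such that $D_pf(t)$ exists for every $t\in(a,b)$. If $f$ has a local maximum (resp. minimum) at $c\in(a,b)$ and for each $t\in(a,b)$, and for all sufficiently small $|h|$, we have $$p(t,h)<t,\quad h<0\qquad(\text{resp. } p(t,h)>t,\quad h>0),$$ $$p(t,h)>t,\quad h>0\qquad(\text{resp. } p(t,h)<t,\quad h<0),$$ then $D_pf(c)=0$.
   Context: Let $I=[a,b]$. Here $p(t,h)$ is a real-valued function defined on $\{(t,h): t\in I,\ |h|<\delta\}$ for some generally unspecified $\delta>0$, and the range of $p$ is assumed to be contained in $I$. The $p$-derivative of $f$ at $t$ is $$D_pf(t)=\lim_{h\to0}\frac{f(p(t,h))-f(t)}{h},$$ and it is said to exist if this limit exists and is finite.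
   Formalization: The formal theorem additionally assumes that p(c,h) tends to c as h tends to 0; without it the claim fails, e.g. f(x)=x²(x-1) on [-1,2], c=0, p(0,h)=-√(-h) for h<0 and 1+h for h≥0, p(t,h)=t+h (truncated) for t≠0, where D_p f(0)=1. *)

(* Defs.v *)
From Stdlib Require Import Reals.
From Coquelicot Require Import Coquelicot.
Open Scope R_scope.

(* [is_lim _ 0 l] is the punctured limit, so [p t 0] is unconstrained. *)
Definition is_Dp (p : R -> R -> R) (f : R -> R) (t l : R) : Prop :=
  is_lim (fun h => (f (p t h) - f t) / h) 0 (Finite l).

Definition ex_Dp (p : R -> R -> R) (f : R -> R) (t : R) : Prop :=
  exists l : R, is_Dp p f t l.

(* A function on [[a, b]] is a total function of which only the values on
   [[a, b]] are used. *)
Definition local_max_on (a b : R) (f : R -> R) (c : R) : Prop :=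
  locally c (fun x => a <= x <= b -> f x <= f c).

Definition local_min_on (a b : R) (f : R -> R) (c : R) : Prop :=
  locally c (fun x => a <= x <= b -> f c <= f x).

(* The existence of [D_p f(t)] does not force [p t h] to tend to [t], and
   without this a local extremum of [f] at [t] says nothing about [f (p t h)].
   For [f x = x ^ 2 * (x - 1)] on [[-1, 2]], which has a local maximum at [0],
   take [p t h = t + h] if [t <> 0] (truncated to [[-1, 2]]), and
   [p 0 h = - sqrt (- h)] if [h < 0], [p 0 h = 1 + h] if [h >= 0]: then
   [p t h - t] has the sign of [h] for small [h], and [D_p f(0) = 1]. *)
Definition p_tends_to_base (p : R -> R -> R) (t : R) : Prop :=
  is_lim (p t) 0 (Finite t).

(* Main.v *)
Require Import Defs.
From Stdlib Require Import Reals Lra.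
From Coquelicot Require Import Coquelicot.
Open Scope R_scope.

(** Since [p c h] tends to [c] as [h] tends to [0], and lies in [[a, b]] for
    small [h], a local maximum of [f] at [c] makes the increment
    [f (p c h) - f c] nonpositive for all small [h <> 0].  Its quotient by [h]
    is then nonpositive on the right of [0] and nonnegative on the left.  As
    this quotient has a two-sided limit, the limit is [0]
    ([lim_quotient_nonpos]).  A local minimum of [f] is a local maximum of
    [- f], and [D_p] commutes with negation. *)

(** Fermat's argument, separated from [f] and [p]: a nonzero limit would force
    [g h / h] to have the sign of [l] on both sides of [0], whereas its sign
    is weakly opposite to that of [h]. *)
Lemma lim_quotient_nonpos (g : R -> R) (l : R) :
  is_lim (fun h => g h / h) 0 (Finite l) ->
  locally' 0 (fun h => g h <= 0) ->
  l = 0.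
Proof.
  intros Hl Hg.
  apply is_lim_spec in Hl.
  destruct (Req_dec l 0) as [E | Hne]; [exact E | exfalso].
  pose proof (Rabs_pos_lt l Hne) as Hpos.
  (* With the tolerance [|l|], the quotient has strictly the sign of [l]. *)
  specialize (Hl (mkposreal _ Hpos)).
  destruct (filter_and _ _ Hl Hg) as [d Hd].
  assert (Hlim : forall h, h <> 0 -> Rabs h < d ->
            Rabs (g h / h - l) < Rabs l /\ g h <= 0).
  { intros h h0 hd. apply Hd; [| exact h0].
    change (Rabs (h - 0) < d). now rewrite Rminus_0_r. }
  pose proof (cond_pos d) as Hd0.
  destruct (Rdichotomy _ _ Hne) as [Hneg | Hgt].
  - destruct (Hlim (- (d / 2))) as [Hq Hgh]; [lra | rewrite Rabs_left; lra |].
    rewrite (Rabs_left l Hneg) in Hq. apply Rabs_def2 in Hq.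
    assert (0 <= g (- (d / 2)) / - (d / 2)); [| lra].
    replace (g (- (d / 2)) / - (d / 2))
      with (- g (- (d / 2)) * / (d / 2)) by (field; lra).
    apply Rmult_le_pos; [lra |].
    apply Rlt_le, Rinv_0_lt_compat; lra.
  - destruct (Hlim (d / 2)) as [Hq Hgh]; [lra | rewrite Rabs_right; lra |].
    rewrite (Rabs_right l) in Hq by lra. apply Rabs_def2 in Hq.
    assert (0 <= - g (d / 2) * / (d / 2)).
    { apply Rmult_le_pos; [lra |].
      apply Rlt_le, Rinv_0_lt_compat; lra. }
    unfold Rdiv at 1 in Hq. lra.
Qed.

Lemma is_Dp_opp (p : R -> R -> R) (f : R -> R) (t l : R) :
  is_Dp p f t l -> is_Dp p (fun x => - f x) t (- l).
Proof.
  intros H.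
  apply is_lim_ext with (fun h => - ((f (p t h) - f t) / h)).
  - intros h. unfold Rdiv. ring.
  - exact (is_lim_opp _ _ _ H).
Qed.

Lemma local_min_on_opp (a b : R) (f : R -> R) (c : R) :
  local_min_on a b f c -> local_max_on a b (fun x => - f x) c.
Proof.
  apply (filter_imp (F := locally c)). intros x Hx Hab. apply Ropp_le_contravar, Hx, Hab.
Qed.

Lemma is_Dp_local_max (a b delta : R) (p : R -> R -> R) (f : R -> R) (c l : R) :
  0 < delta ->
  (forall h : R, Rabs h < delta -> a <= p c h <= b) ->
  p_tends_to_base p c ->
  local_max_on a b f c ->
  is_Dp p f c l ->
  l = 0.
Proof.
  intros Hdelta Hp Hbase Hmax Hl.
  apply (lim_quotient_nonpos (fun h => f (p c h) - f c)); [exact Hl |].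
  (* Pulling the neighbourhood of [c] back along [p c] gives a punctured
     neighbourhood of [0]. *)
  pose proof (Hbase _ Hmax) as Hnear.
  assert (Hdom : locally' 0 (fun h => Rabs h < delta)).
  { exists (mkposreal _ Hdelta). intros h Hh _.
    change (Rabs (h - 0) < delta) in Hh. now rewrite Rminus_0_r in Hh. }
  generalize (filter_and (F := locally' 0) _ _ Hnear Hdom).
  apply (filter_imp (F := locally' 0)).
  intros h [Hle Hh]. specialize (Hle (Hp h Hh)). lra.
Qed.

Theorem theorem3p3 (a b delta : R) (p : R -> R -> R) (f : R -> R) (c : R)
    (Hdelta : 0 < delta)
    (Hp : forall t h : R, a <= t <= b -> Rabs h < delta -> a <= p t h <= b)
    (Hf : forall t : R, a < t < b -> ex_Dp p f t)
    (Hc : a < c < b)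
    (Hbase : p_tends_to_base p c) :
  (local_max_on a b f c ->
   (forall t : R, a < t < b ->
      locally 0 (fun h => (h < 0 -> p t h < t) /\ (h > 0 -> p t h > t))) ->
   is_Dp p f c 0)
  /\
  (local_min_on a b f c ->
   (forall t : R, a < t < b ->
      locally 0 (fun h => (h > 0 -> p t h > t) /\ (h < 0 -> p t h < t))) ->
   is_Dp p f c 0).
Proof.
  destruct (Hf c Hc) as [l Hl].
  assert (Hpc : forall h, Rabs h < delta -> a <= p c h <= b).
  { intros h. apply Hp. lra. }
  split; intros Hext _.
  - now rewrite <- (is_Dp_local_max a b delta p f c l Hdelta Hpc Hbase Hext Hl).
  - assert (E : - l = 0).
    { exact (is_Dp_local_max a b delta p _ c (- l) Hdelta Hpc Hbase
               (local_min_on_opp _ _ _ _ Hext) (is_Dp_opp _ _ _ _ Hl)). }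
    replace 0 with l by lra. exact Hl.
Qed.
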